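(* Let $n,p$ be positive integers. Then $$[U_{n\otimes p}]=\left(U^{i_1i_2}_{j_1j_2}\right)=\left(\delta^{i_1i_2}_{j_2j_1}\right)=\left(\delta^{i_1}_{j_2}\delta^{i_2}_{j_1}\right),$$ where $i_1i_2=11,12,\ldots,1n,21,22,\ldots,2n,\ldots,p1,p2,\ldots,pn$ are the row indices and $j_1j_2=11,12,\ldots,1p,21,22,\ldots,2p,\ldots,n1,n2,\ldots,np$ are the column indices.
   Context: The tensor commutation matrix $[U_{n\otimes p}]$ is the $np\times np$ matrix with entries $0$ and $1$ such that $[U_{n\otimes p}]\cdot([a]\otimes[b])=[b]\otimes[a]$ for all $[a]\in\mathcal{M}_{n\times 1}(\mathbb{K})$, $[b]\in\mathcal{M}_{p\times 1}(\mathbb{K})$, where $\mathbb{K}=\mathbb{R}$ or $\mathbb{C}$ and $\otimes$ is the Kronecker product of matrices (the $(i,j)$ block of $[A]\otimes[B]$ is $A^i_j[B]$). $\delta^i_j$ is the Kronecker symbol, and $\delta^{i_1i_2}_{j_1j_2}=\delta^{i_1}_{j_1}\delta^{i_2}_{j_2}$. Rows and columns are labelled by the double indices in the listed (lexicographic) order: row $i_1i_2$ (with $1\le i_1\le p$, $1\le i_2\le n$) is the row numbered $n(i_1-1)+i_2$, and column $j_1j_2$ (with $1\le j_1\le n$, $1\le j_2\le p$) is the column numbered $p(j_1-1)+j_2$. *)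

(* Defs.v *)
From mathcomp Require Import all_boot all_order all_algebra.
From mathcomp Require Import mxtens complex reals.

Set Implicit Arguments.
Unset Strict Implicit.
Unset Printing Implicit Defensive.

Import GRing.Theory.
Local Open Scope ring_scope.
Local Open Scope complex_scope.

Variant real_or_complex (R : realType) : fieldType -> Prop :=
| RealScalars : real_or_complex R R
| ComplexScalars : real_or_complex R R[i].

Definition kdelta (K : fieldType) (n : nat) (i j : 'I_n) : K := (i == j)%:R.

(* Upper indices i1 i2, lower indices j1 j2. *)
Definition kdelta2 (K : fieldType) (m n : nat)
    (i1 : 'I_m) (i2 : 'I_n) (j1 : 'I_m) (j2 : 'I_n) : K :=
  kdelta K i1 j1 * kdelta K i2 j2.

(* [A *t B] is the Kronecker product, whose (i, j) block is [A i j *: B]; it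
   labels its rows and columns through [mxtens_index], which sends (i1, i2) in
   'I_p * 'I_n to i1 * n + i2, the lexicographic rank counted from 0.
   The square matrix U is given the dimensions (p * n, n * p) rather than
   (n * p, n * p) because its rows are labelled by 'I_p * 'I_n and its columns
   by 'I_n * 'I_p; the defining identity then needs no cast. *)
Definition is_tensor_commutation_mx (K : fieldType) (n p : nat)
    (U : 'M[K]_(p * n, n * p)) : Prop :=
  (forall r s, U r s = 0 \/ U r s = 1) /\
  (forall (a : 'cV[K]_n) (b : 'cV[K]_p), U *m (a *t b) = b *t a).

(* Main.v *)
Require Import Defs.
From mathcomp Require Import all_boot all_order all_algebra.
From mathcomp Require Import mxtens complex reals.

Import GRing.Theory.
Local Open Scope ring_scope.

(** The Kronecker products of the standard basis columns of K^n and K^p are the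
    standard basis columns of K^(np) ([tensmx_delta]).  Applied to them, the
    identity U (a (x) b) = b (x) a says that the column of U with label j1 j2 is
    the basis vector with label j2 j1, which determines every entry of U
    ([tensor_commutation_mx_entry]) and hence U itself.  Conversely, each row of
    the matrix with these entries selects a single coordinate of a (x) b, so the
    identity holds for all a and b ([swap_mxP]). *)

Lemma tensmx_delta (R : pzRingType) (m n p q : nat)
    (i : 'I_m) (j : 'I_n) (k : 'I_p) (l : 'I_q) :
  delta_mx i j *t delta_mx k l
    = delta_mx (mxtens_index (i, k)) (mxtens_index (j, l)) :> 'M[R]_(_, _).
Proof.
apply/matrixP => r s.
case: (mxtens_indexP r) => r1 r2; case: (mxtens_indexP s) => s1 s2.
rewrite tensmxE !mxE !(can_eq (@mxtens_indexK _ _)) !xpair_eqE -natrM mulnb.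
by rewrite andbACA.
Qed.

Lemma mulmx_delta_entry (R : pzRingType) (m n p : nat) (A : 'M[R]_(m, n))
    (i : 'I_m) (j : 'I_n) (k : 'I_p) :
  (A *m delta_mx j k) i k = A i j.
Proof.
rewrite mxE (bigD1 j) //= !mxE !eqxx mulr1 big1 ?addr0 // => l /negPf nlj.
by rewrite mxE nlj mulr0.
Qed.

(** Taking basis columns for a and b turns U (a (x) b) into a single column of U
    and b (x) a into a basis column. *)
Lemma tensor_commutation_mx_entry (K : fieldType) (n p : nat)
    (U : 'M[K]_(p * n, n * p))
    (swapU : forall (a : 'cV[K]_n) (b : 'cV[K]_p), U *m (a *t b) = b *t a)
    (i1 : 'I_p) (i2 : 'I_n) (j1 : 'I_n) (j2 : 'I_p) :
  U (mxtens_index (i1, i2)) (mxtens_index (j1, j2)) = kdelta2 K i1 i2 j2 j1.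
Proof.
rewrite -(mulmx_delta_entry _ _ _ _ U _ _ (mxtens_index (0 : 'I_1, 0 : 'I_1))).
by rewrite -tensmx_delta swapU tensmxE !mxE !andbT.
Qed.

Definition swap_mx (K : fieldType) (n p : nat) : 'M[K]_(p * n, n * p) :=
  \matrix_(r, s) kdelta2 K (mxtens_unindex r).1 (mxtens_unindex r).2
                           (mxtens_unindex s).2 (mxtens_unindex s).1.

Lemma kdelta2_pair (K : fieldType) (m n : nat)
    (i1 : 'I_m) (i2 : 'I_n) (j1 : 'I_m) (j2 : 'I_n) :
  kdelta2 K i1 i2 j1 j2 = ((i1, i2) == (j1, j2))%:R.
Proof. by rewrite /kdelta2 /kdelta -natrM mulnb. Qed.

(** Row i1 i2 of the matrix has its single 1 in column i2 i1, so its product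
    with a (x) b is a_{i2} b_{i1}, the entry of b (x) a with label i1 i2. *)
Lemma swap_mxP (K : fieldType) (n p : nat) :
  is_tensor_commutation_mx (swap_mx K n p).
Proof.
split=> [r s | a b].
  by rewrite mxE kdelta2_pair; case: eqP; [right | left].
apply/matrixP => r c.
case: (mxtens_indexP r) => i1 i2; case: (mxtens_indexP c) => c1 c2.
(* Both column labels range over 'I_1, so a and b may exchange theirs. *)
rewrite (ord1 c1) (ord1 c2) tensmxE mxE (bigD1 (mxtens_index (i2, i1))) //=.
rewrite tensmxE mxE !mxtens_indexK kdelta2_pair eqxx mul1r mulrC big1 ?addr0 //.
move=> s; case: (mxtens_indexP s) => j1 j2.
rewrite (can_eq (@mxtens_indexK _ _)) xpair_eqE => neq_j.
rewrite mxE !mxtens_indexK kdelta2_pair xpair_eqE andbC.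
by rewrite (eq_sym i2) (eq_sym i1) (negPf neq_j) mul0r.
Qed.

Theorem proposition0p6p1 (R : realType) (K : fieldType)
    (hK : real_or_complex R K) (n p : nat) (hn : (0 < n)%N) (hp : (0 < p)%N) :
  (exists! U : 'M[K]_(p * n, n * p), is_tensor_commutation_mx U) /\
  (forall U : 'M[K]_(p * n, n * p), is_tensor_commutation_mx U ->
     forall (i1 : 'I_p) (i2 : 'I_n) (j1 : 'I_n) (j2 : 'I_p),
       U (mxtens_index (i1, i2)) (mxtens_index (j1, j2))
         = kdelta2 K i1 i2 j2 j1 /\
       kdelta2 K i1 i2 j2 j1 = kdelta K i1 j2 * kdelta K i2 j1).
Proof.
split=> [|U [_ swapU] i1 i2 j1 j2]; last first.
  by split; first exact: tensor_commutation_mx_entry.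
exists (swap_mx K n p); split=> [|U [_ swapU]]; first exact: swap_mxP.
apply/matrixP => r s.
case: (mxtens_indexP r) => i1 i2; case: (mxtens_indexP s) => j1 j2.
by rewrite (tensor_commutation_mx_entry _ _ _ U) // mxE !mxtens_indexK.
Qed.
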